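(* Let $\mathcal{A}$ be a metric $\mathcal{L}$-structure and let $\mathcal{I}$ and $\mathcal{J}$ be atomless ideals on a set $\Omega$. Then the reduced powers of $\mathcal{A}$ over $\mathcal{I}$ and over $\mathcal{J}$ are elementarily equivalent.
   Context: Continuous logic for metric structures with $[0,1]$-valued formulas; $\equiv$ means every $\mathcal{L}$-sentence takes the same value in both structures. An ideal $\mathcal{I}$ on $\Omega$ (proper, i.e. $\Omega\notin\mathcal{I}$) is atomless if the Boolean algebra $P(\Omega)/\mathcal{I}$ is atomless. The reduced power of $\mathcal{A}$ over $\mathcal{I}$ is the reduced product $\prod_{\mathcal{I}}\mathcal{A}_\gamma$ with $\mathcal{A}_\gamma=\mathcal{A}$ for all $\gamma$: the quotient of $\mathcal{A}^\Omega$ by $d_{\mathcal{I}}(x,y)=\inf_{S\in\mathcal{I}}\sup_{\gamma\notin S}d(x(\gamma),y(\gamma))=0$, with predicates interpreted as $\inf_{S\in\mathcal{I}}\sup_{\gamma\notin S}$ of coordinatewise values and functions and constants coordinatewise. *)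

(* Defs.v *)
From HB Require Import structures.
From mathcomp Require Import all_boot all_order all_algebra.
From mathcomp Require Import generic_quotient.
From mathcomp Require Import all_classical all_reals.
From mathcomp Require Import topology normedtype sequences.
From mathcomp Require Import lra.

Set Implicit Arguments.
Unset Strict Implicit.
Unset Printing Implicit Defensive.

Import Order.TTheory GRing.Theory Num.Theory.
Import numFieldNormedType.Exports.

Local Open Scope classical_set_scope.
Local Open Scope ring_scope.
Local Open Scope quotient_scope.

Definition unit_cube (R : realType) (k : nat) : set 'rV[R]_k :=
  [set x | forall i, 0 <= x ord0 i <= 1].

Record connective (R : realType) (k : nat) := Connective {
  conn_fun :> 'rV[R]_k -> R ;
  conn_cts : {within @unit_cube R k, continuous conn_fun} ;
  conn_itv : forall x, unit_cube x -> 0 <= conn_fun x <= 1 }.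

Definition is_modulus (R : realType) (D : R -> R) : Prop :=
  forall e, 0 < e <= 1 -> 0 < D e <= 1.

Record language (R : realType) := Language {
  pred_sym : Type ;
  pred_ar : pred_sym -> nat ;
  pred_mod : pred_sym -> R -> R ;
  pred_modP : forall P, is_modulus (pred_mod P) ;
  fun_sym : Type ;
  fun_ar : fun_sym -> nat ;
  fun_mod : fun_sym -> R -> R ;
  fun_modP : forall f, is_modulus (fun_mod f) ;
  const_sym : Type }.

Record mstructure (R : realType) (L : language R) := MStructure {
  carrier :> metricType R ;
  carrier_inh : inhabited carrier ;
  mdist_le1 : forall x y : carrier, mdist x y <= 1 ;
  carrier_complete : forall u : nat -> carrier,
    cauchy (u @ \oo) -> exists p : carrier, u @ \oo --> p ;
  pred_int : forall P : pred_sym L, ('I_(pred_ar P) -> carrier) -> R ;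
  pred_int_itv : forall P x, 0 <= @pred_int P x <= 1 ;
  pred_int_uc : forall P e (x y : 'I_(pred_ar P) -> carrier), 0 < e <= 1 ->
    (forall i, mdist (x i) (y i) < pred_mod P e) ->
    `|@pred_int P x - @pred_int P y| <= e ;
  fun_int : forall f : fun_sym L, ('I_(fun_ar f) -> carrier) -> carrier ;
  fun_int_uc : forall f e (x y : 'I_(fun_ar f) -> carrier), 0 < e <= 1 ->
    (forall i, mdist (x i) (y i) < fun_mod f e) ->
    mdist (@fun_int f x) (@fun_int f y) <= e ;
  const_int : const_sym L -> carrier }.
Arguments pred_int {R L} m P _.
Arguments fun_int {R L} m f _.
Arguments const_int {R L} m c.

Section Syntax.
Context {R : realType} (L : language R).

Inductive term : Type :=
| Var of nat
| Const of const_sym L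
| App (f : fun_sym L) of 'I_(fun_ar f) -> term.

Inductive formula : Type :=
| Dist of term & term
| Pred (P : pred_sym L) of 'I_(pred_ar P) -> term
| Conn (k : nat) of connective R k & ('I_k -> formula)
| Sup of nat & formula
| Inf of nat & formula.

Fixpoint term_free (x : nat) (t : term) : Prop :=
  match t with
  | Var y => x = y
  | Const _ => False
  | App f ts => exists i, term_free x (ts i)
  end.

Fixpoint free (x : nat) (phi : formula) : Prop :=
  match phi with
  | Dist s t => term_free x s \/ term_free x t
  | Pred P ts => exists i, term_free x (ts i)
  | Conn k u phis => exists i, free x (phis i)
  | Sup y psi => x <> y /\ free x psi
  | Inf y psi => x <> y /\ free x psi
  end.

Definition sentence (phi : formula) : Prop := forall x, ~ free x phi.

End Syntax.

Section Semantics.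
Context {R : realType} {L : language R}.

Definition upd (T : Type) (v : nat -> T) (x : nat) (a : T) : nat -> T :=
  fun y => if y == x then a else v y.

Fixpoint teval (M : mstructure L) (v : nat -> M) (t : term L) : M :=
  match t with
  | Var x => v x
  | Const c => const_int M c
  | App f ts => fun_int M f (fun i => teval v (ts i))
  end.

Fixpoint feval (M : mstructure L) (phi : formula L) (v : nat -> M) : R :=
  match phi with
  | Dist s t => mdist (teval v s) (teval v t)
  | Pred P ts => pred_int M P (fun i => teval v (ts i))
  | Conn k u phis => u (\row_i feval (phis i) v)
  | Sup x psi => sup (range (fun a : M => feval psi (upd v x a)))
  | Inf x psi => inf (range (fun a : M => feval psi (upd v x a)))
  end.

(* The value of a sentence does not depend on the assignment
   (feval_sentence), so quantifying over both assignments is harmless. *)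
Definition elem_equiv (M N : mstructure L) : Prop :=
  forall phi, sentence phi ->
  forall (v : nat -> M) (w : nat -> N), feval phi v = feval phi w.

Lemma teval_free (M : mstructure L) (t : term L) (v w : nat -> M) :
  (forall x, term_free x t -> v x = w x) -> teval v t = teval w t.
Proof.
elim: t => [x|c|f ts IH] //= vw; first exact: vw.
by congr fun_int; apply/funext => i; apply: IH => x xf; apply: vw; exists i.
Qed.

Lemma feval_free (M : mstructure L) (phi : formula L) (v w : nat -> M) :
  (forall x, free x phi -> v x = w x) -> feval phi v = feval phi w.
Proof.
elim: phi v w => [s t|P ts|k u phis IH|x psi IH|x psi IH] v w vw /=.
- by congr mdist; apply: teval_free => x xf; apply: vw; [left|right].
- by congr pred_int; apply/funext => i; apply: teval_free => x xf; apply: vw;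
    exists i.
- congr (conn_fun u _); apply/rowP => i; rewrite !mxE.
  by apply: IH => x xf; apply: vw; exists i.
- suff -> : (fun a => feval psi (upd v x a)) = fun a => feval psi (upd w x a) by [].
  apply/funext => a; apply: IH => y yf.
  by rewrite /upd; case: eqP => // /eqP yx; apply: vw; split => //; apply/eqP.
- suff -> : (fun a => feval psi (upd v x a)) = fun a => feval psi (upd w x a) by [].
  apply/funext => a; apply: IH => y yf.
  by rewrite /upd; case: eqP => // /eqP yx; apply: vw; split => //; apply/eqP.
Qed.

Lemma feval_sentence (M : mstructure L) (phi : formula L) (v w : nat -> M) :
  sentence phi -> feval phi v = feval phi w.
Proof. by move=> sphi; apply: feval_free => x /sphi. Qed.

Lemma feval_itv (M : mstructure L) (phi : formula L) (v : nat -> M) :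
  0 <= feval phi v <= 1.
Proof.
have [a0] := carrier_inh M.
elim: phi v => [s t|P ts|k u phis IH|x psi IH|x psi IH] v /=.
- by rewrite mdist_ge0 mdist_le1.
- exact: pred_int_itv.
- by apply: conn_itv => i; rewrite mxE.
- have ub : ubound (range (fun a : M => feval psi (upd v x a))) 1.
    by move=> _ [a _ <-]; have /andP[] := IH (upd v x a).
  apply/andP; split; last first.
    by apply: ge_sup => //; exists (feval psi (upd v x a0)), a0.
  have /andP[h _] := IH (upd v x a0); apply: (le_trans h).
  by apply: ub_le_sup; [exists 1|exists a0].
- have lb : lbound (range (fun a : M => feval psi (upd v x a))) 0.
    by move=> _ [a _ <-]; have /andP[] := IH (upd v x a).
  apply/andP; split.
    by apply: lb_le_inf => //; exists (feval psi (upd v x a0)), a0.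
  have /andP[_ h] := IH (upd v x a0); apply: le_trans h.
  by apply: ge_inf; [exists 0|exists a0].
Qed.

End Semantics.

Record ideal (Omega : Type) := Ideal {
  ideal_mem :> set Omega -> Prop ;
  ideal0 : ideal_mem set0 ;
  idealS : forall S T, S `<=` T -> ideal_mem T -> ideal_mem S ;
  idealU : forall S T, ideal_mem S -> ideal_mem T -> ideal_mem (S `|` T) ;
  ideal_proper : ~ ideal_mem setT }.

Definition atom (d : Order.disp_t) (B : ctbDistrLatticeType d) (b : B) : Prop :=
  b <> \bot%O /\ forall x : B, (x <= b)%O -> x = \bot%O \/ x = b.

Definition atomless_alg (d : Order.disp_t) (B : ctbDistrLatticeType d) : Prop :=
  ~ exists b : B, atom b.

Section QuotientAlgebra.
Context {Omega : Type} (I : ideal Omega).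
Implicit Types S T U : set Omega.

Definition ideal_rel : rel (set Omega) := fun S T => `[< I (S `+` T) >].

Lemma ideal_relP S T : ideal_rel S T <->
  exists2 N, I N & forall g, ~ N g -> (S g <-> T g).
Proof.
split=> [/asboolP IST|[N IN ST]].
  exists (S `+` T) => // g nST; split => h; apply: contrapT => nh; apply: nST.
  - by left.
  - by right.
apply/asboolP; apply: idealS IN => g h; apply: contrapT => /ST e.
by move: h => [[+ n]|[+ n]]; [move/e|move/e].
Qed.

Lemma ideal_rel_refl : reflexive ideal_rel.
Proof. by move=> S; apply/ideal_relP; exists set0 => //; exact: ideal0. Qed.

Lemma ideal_rel_sym : symmetric ideal_rel.
Proof. by move=> S T; rewrite /ideal_rel setYC. Qed.

Lemma ideal_rel_trans : transitive ideal_rel.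
Proof.
move=> T S U /ideal_relP[N IN ST] /ideal_relP[N' IN' TU].
apply/ideal_relP; exists (N `|` N'); first exact: idealU.
by move=> g nN; rewrite ST ?TU// => h; apply: nN; [right|left].
Qed.

Canonical ideal_equiv :=
  EquivRel ideal_rel ideal_rel_refl ideal_rel_sym ideal_rel_trans.

Definition quot_alg := {eq_quot ideal_equiv}.
HB.instance Definition _ := Choice.on quot_alg.
HB.instance Definition _ := Quotient.on quot_alg.

Definition qcl (S : set Omega) : quot_alg := \pi_quot_alg S.

Lemma qclP S T : qcl S = qcl T <->
  exists2 N, I N & forall g, ~ N g -> (S g <-> T g).
Proof.
by rewrite -ideal_relP; split => [/eqquotP|h]//; apply/eqquotP.
Qed.

Definition qmeet (a b : quot_alg) := qcl (repr a `&` repr b).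
Definition qjoin (a b : quot_alg) := qcl (repr a `|` repr b).
Definition qcompl (a : quot_alg) := qcl (~` repr a).
Definition qle (a b : quot_alg) := qmeet a b == a.
Definition qlt (a b : quot_alg) := (b != a) && qle a b.

Lemma repr_qcl S : exists2 N, I N & forall g, ~ N g -> (repr (qcl S) g <-> S g).
Proof. by apply/qclP; rewrite /qcl reprK. Qed.

Lemma qmeetE S T : qmeet (qcl S) (qcl T) = qcl (S `&` T).
Proof.
have [N IN SN] := repr_qcl S; have [N' IN' TN] := repr_qcl T.
apply/qclP; exists (N `|` N'); first exact: idealU.
move=> g nN; have := SN g (fun h => nN (or_introl h)).
have := TN g (fun h => nN (or_intror h)).
by rewrite /setI/=; tauto.
Qed.

Lemma qjoinE S T : qjoin (qcl S) (qcl T) = qcl (S `|` T).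
Proof.
have [N IN SN] := repr_qcl S; have [N' IN' TN] := repr_qcl T.
apply/qclP; exists (N `|` N'); first exact: idealU.
move=> g nN; have := SN g (fun h => nN (or_introl h)).
have := TN g (fun h => nN (or_intror h)).
by rewrite /setU/=; tauto.
Qed.

Lemma qcomplE S : qcompl (qcl S) = qcl (~` S).
Proof.
have [N IN SN] := repr_qcl S.
by apply/qclP; exists N => // g /SN; rewrite /setC/=; tauto.
Qed.

Lemma quot_algP (P : quot_alg -> Prop) : (forall S, P (qcl S)) -> forall a, P a.
Proof. by move=> h a; have := h (repr a); rewrite /qcl reprK. Qed.

Lemma qmeetC : commutative qmeet.
Proof. by move=> a b; rewrite /qmeet setIC. Qed.
Lemma qjoinC : commutative qjoin.
Proof. by move=> a b; rewrite /qjoin setUC. Qed.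
Lemma qmeetA : associative qmeet.
Proof.
by elim/quot_algP => S; elim/quot_algP => T; elim/quot_algP => U;
  rewrite !qmeetE setIA.
Qed.
Lemma qjoinA : associative qjoin.
Proof.
by elim/quot_algP => S; elim/quot_algP => T; elim/quot_algP => U;
  rewrite !qjoinE setUA.
Qed.
Lemma qjoinKI (b a : quot_alg) : qmeet a (qjoin a b) = a.
Proof.
by elim/quot_algP: a => S; elim/quot_algP: b => T;
  rewrite qjoinE qmeetE setUC setKU.
Qed.
Lemma qmeetKU (b a : quot_alg) : qjoin a (qmeet a b) = a.
Proof.
by elim/quot_algP: a => S; elim/quot_algP: b => T;
  rewrite qmeetE qjoinE setIC setKI.
Qed.
Lemma qmeetUl : left_distributive qmeet qjoin.
Proof.
by elim/quot_algP => S; elim/quot_algP => T; elim/quot_algP => U;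
  rewrite !(qmeetE, qjoinE) setIUl.
Qed.
Lemma qmeetxx : idempotent_op qmeet.
Proof. by elim/quot_algP => S; rewrite qmeetE setIid. Qed.

Fact quot_alg_display : Order.disp_t. Proof. exact: Order.Disp tt tt. Qed.

HB.instance Definition _ := Order.isMeetJoinDistrLattice.Build
  quot_alg_display quot_alg (fun _ _ => erefl) (fun _ _ => erefl)
  qmeetC qjoinC qmeetA qjoinA qjoinKI qmeetKU qmeetUl qmeetxx.

Lemma qle0x (a : quot_alg) : (qcl set0 <= a)%O.
Proof.
by elim/quot_algP: a => S; apply/eqP; have := qmeetE set0 S; rewrite set0I.
Qed.
Lemma qlex1 (a : quot_alg) : (a <= qcl setT)%O.
Proof.
by elim/quot_algP: a => S; apply/eqP; have := qmeetE S setT; rewrite setIT.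
Qed.

HB.instance Definition _ := Order.hasBottom.Build quot_alg_display quot_alg qle0x.
HB.instance Definition _ := Order.hasTop.Build quot_alg_display quot_alg qlex1.

Lemma qjoinxC (a : quot_alg) : (a `|` qcompl a)%O = \top%O.
Proof.
elim/quot_algP: a => S; rewrite qcomplE.
by apply: (etrans (qjoinE _ _)); rewrite setUv.
Qed.
Lemma qmeetxC (a : quot_alg) : (a `&` qcompl a)%O = \bot%O.
Proof.
elim/quot_algP: a => S; rewrite qcomplE.
by apply: (etrans (qmeetE _ _)); rewrite setICr.
Qed.

HB.instance Definition _ := Order.TBDistrLattice_hasComplement.Build
  quot_alg_display quot_alg qjoinxC qmeetxC.

Definition atomless : Prop := atomless_alg quot_alg.

Lemma qcl_eq0 S : qcl S = \bot%O <-> I S.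
Proof.
split=> [/qclP[N IN h]|IS]; last first.
  by apply/qclP; exists S => // g nS; split.
by apply: idealS IN => g Sg; apply: contrapT => /h/iffLR/(_ Sg).
Qed.

Lemma atomlessP : atomless <->
  forall S, ~ I S -> exists T, [/\ T `<=` S, ~ I T & ~ I (S `\` T)].
Proof.
split=> [al S nIS|H [b []]].
  apply: contrapT => nT; apply: al; exists (qcl S).
  split=> [/qcl_eq0//|b]; elim/quot_algP: b => T /eqP.
  move=> /(etrans (esym (qmeetE T S))) TS.
  have [ITS|nITS] := pselect (I (T `&` S)).
    by left; rewrite -TS; apply/qcl_eq0.
  right; rewrite -TS; apply/qclP; exists (S `\` (T `&` S)); last first.
    by move=> g h; split=> [[]//|Sg]; apply: contrapT => n; apply: h.
  apply: contrapT => n; apply: nT; exists (T `&` S); split => //.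
elim/quot_algP: b => S nS min.
have [|T [TS nT nST]] := H S; first by move=> /qcl_eq0.
case: (min (qcl T)); first by apply/eqP/(etrans (qmeetE T S));
  rewrite (setIidPl T S).2.
- by move=> /qcl_eq0.
- move=> /qclP[N IN h]; apply: nST; apply: idealS IN => g [Sg nTg].
  by apply: contrapT => /h/iffRL/(_ Sg).
Qed.

End QuotientAlgebra.

Section LimsupIdeal.
Context {R : realType} {Omega : Type} (I : ideal Omega).
Implicit Types f : Omega -> R.

Definition limsupI f : R := inf [set sup (f @` (~` S)) | S in (I : set (set Omega))].

Lemma ideal_notin (S : set Omega) : I S -> exists g, ~ S g.
Proof.
move=> IS; apply: contrapT => h; apply: (@ideal_proper _ I).
by apply: idealS IS => g _; apply: contrapT => ?; apply: h; exists g.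
Qed.

Let unitv f := forall g, 0 <= f g <= 1.

Lemma sup_itv f (S : set Omega) : unitv f -> I S -> 0 <= sup (f @` (~` S)).
Proof.
move=> f01 /ideal_notin[g Sg]; have /andP[h _] := f01 g; apply: (le_trans h).
apply: ub_le_sup; last by exists g.
by exists 1 => _ [g' _ <-]; have /andP[] := f01 g'.
Qed.

Lemma limsupI_ge0 f : unitv f -> 0 <= limsupI f.
Proof.
move=> f01; apply: lb_le_inf.
  by exists (sup (f @` (~` set0))), set0 => //; exact: ideal0.
by move=> _ [S IS <-]; exact: sup_itv.
Qed.

Lemma limsupI_le f (S : set Omega) r : unitv f -> I S ->
  (forall g, ~ S g -> f g <= r) -> limsupI f <= r.
Proof.
move=> f01 IS fr; apply: (@le_trans _ _ (sup (f @` (~` S)))).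
  apply: ge_inf; last by exists S.
  by exists 0 => _ [T IT <-]; exact: sup_itv.
apply: ge_sup; last by move=> _ [g Sg <-]; exact: fr.
by have [g Sg] := ideal_notin IS; exists (f g), g.
Qed.

Lemma limsupI_lt f r : unitv f -> limsupI f < r ->
  exists2 S, I S & exists2 r', r' < r & forall g, ~ S g -> f g <= r'.
Proof.
move=> f01 /inf_lt[].
  by exists (sup (f @` (~` set0))), set0 => //; exact: ideal0.
move=> _ [S IS <-] sr; exists S => //; exists (sup (f @` (~` S))) => // g Sg.
apply: ub_le_sup; last by exists g.
by exists 1 => _ [g' _ <-]; have /andP[] := f01 g'.
Qed.

Lemma limsupI_itv f : unitv f -> 0 <= limsupI f <= 1.
Proof.
move=> f01; rewrite limsupI_ge0//=; apply: (limsupI_le f01 (ideal0 I)) => g _.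
by have /andP[] := f01 g.
Qed.

Lemma limsupI_leD f (g : Omega -> R) (S : set Omega) e : unitv f -> unitv g -> I S ->
  (forall x, ~ S x -> f x <= g x + e) -> limsupI f <= limsupI g + e.
Proof.
move=> f01 g01 IS fg; apply/ler_addgt0Pr => d d0.
have [T IT [r rd gr]] : exists2 T, I T &
    exists2 r, r < limsupI g + d & forall x, ~ T x -> g x <= r.
  by apply: limsupI_lt => //; rewrite ltrDl.
apply: (limsupI_le f01 (idealU IS IT)) => x nST.
have := fg x (fun h => nST (or_introl h)).
have := gr x (fun h => nST (or_intror h)); lra.
Qed.

Lemma limsupI_dist f (g : Omega -> R) (S : set Omega) e : unitv f -> unitv g -> I S ->
  (forall x, ~ S x -> `|f x - g x| <= e) -> `|limsupI f - limsupI g| <= e.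
Proof.
move=> f01 g01 IS fg.
have h1 : limsupI f <= limsupI g + e.
  apply: limsupI_leD IS _ => // x /fg; rewrite ler_norml; lra.
have h2 : limsupI g <= limsupI f + e.
  apply: limsupI_leD IS _ => // x /fg; rewrite ler_norml; lra.
by rewrite ler_norml; lra.
Qed.

Lemma ideal_bigU n (S : 'I_n -> set Omega) :
  (forall i, I (S i)) -> I [set g | exists i, S i g].
Proof.
move=> IS.
suff H : forall s : seq 'I_n, I [set g | exists2 i, i \in s & S i g].
  by apply: idealS (H (enum 'I_n)) => g [i Si]; exists i; rewrite ?mem_enum.
elim=> [|i s IH]; first by apply: idealS (ideal0 I) => g [].
apply: idealS (idealU (IS i) IH) => g [j]; rewrite inE => /orP[/eqP->|js] Sj.
  by left.
by right; exists j.
Qed.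

Lemma limsupI_family_lt n (f : 'I_n -> Omega -> R) r :
  (forall i, unitv (f i)) -> (forall i, limsupI (f i) < r) ->
  exists2 S, I S & forall g, ~ S g -> forall i, f i g < r.
Proof.
move=> f01 fr.
have /choice[S HS] : forall i, exists S, I S /\ forall g, ~ S g -> f i g < r.
  move=> i; have [S IS [r' r'r h]] := limsupI_lt (f01 i) (fr i).
  by exists S; split => // g /h /le_lt_trans; apply.
exists [set g | exists i, S i g]; first by apply: ideal_bigU => i; have [] := HS i.
by move=> g nS i; apply: (HS i).2 => Sg; apply: nS; exists i.
Qed.

End LimsupIdeal.

Section ReducedProduct.
Context {R : realType} {L : language R} {Omega : Type}.
Variables (I : ideal Omega) (A : Omega -> mstructure L).

Let X := forall g, A g.
Implicit Types x y z : X.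

Definition distI x y : R := limsupI I (fun g => mdist (x g) (y g)).

Lemma dist_itv x y g : 0 <= mdist (x g) (y g) <= 1.
Proof. by rewrite mdist_ge0 mdist_le1. Qed.

Lemma distIxx x : distI x x = 0.
Proof.
apply/eqP; rewrite eq_le limsupI_ge0 ?andbT; last exact: dist_itv.
by apply: (limsupI_le (dist_itv x x) (ideal0 I)) => g _; rewrite mdistxx.
Qed.

Lemma distI_sym x y : distI x y = distI y x.
Proof. by congr limsupI; apply/funext => g; rewrite metric_sym. Qed.

Lemma distI_triangle y x z : distI x z <= distI x y + distI y z.
Proof.
apply/ler_addgt0Pr => e e0.
have e2 : 0 < e / 2 by rewrite divr_gt0.
have [S IS [r rS hS]] : exists2 S, I S & exists2 r, r < distI x y + e / 2 &
    forall g, ~ S g -> mdist (x g) (y g) <= r.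
  by apply: limsupI_lt; [exact: dist_itv|rewrite ltrDl].
have [T IT [s sT hT]] : exists2 S, I S & exists2 r, r < distI y z + e / 2 &
    forall g, ~ S g -> mdist (y g) (z g) <= r.
  by apply: limsupI_lt; [exact: dist_itv|rewrite ltrDl].
apply: (limsupI_le (dist_itv x z) (idealU IS IT)) => g nST.
have h1 := hS g (fun h => nST (or_introl h)).
have h2 := hT g (fun h => nST (or_intror h)).
have h3 := metric_triangle (x g) (y g) (z g).
rewrite -lerBlDr in h3; lra.
Qed.

Lemma distI_ge0 x y : 0 <= distI x y.
Proof. by apply: limsupI_ge0 => g; exact: dist_itv. Qed.

Definition rp_rel : rel X := fun x y => distI x y == 0.

Lemma rp_rel_refl : reflexive rp_rel.
Proof. by move=> x; rewrite /rp_rel distIxx. Qed.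
Lemma rp_rel_sym : symmetric rp_rel.
Proof. by move=> x y; rewrite /rp_rel distI_sym. Qed.
Lemma rp_rel_trans : transitive rp_rel.
Proof.
move=> y x z /eqP xy /eqP yz; rewrite /rp_rel eq_le distI_ge0 andbT.
by rewrite (le_trans (distI_triangle y x z))// xy yz addr0.
Qed.

Canonical rp_equiv := EquivRel rp_rel rp_rel_refl rp_rel_sym rp_rel_trans.

Definition rp_type := {eq_quot rp_equiv}.
HB.instance Definition _ := Choice.on rp_type.
HB.instance Definition _ := Quotient.on rp_type.

Definition rp_class x : rp_type := \pi_rp_type x.

Lemma rp_classP x y : rp_class x = rp_class y <-> distI x y = 0.
Proof.
by split => [/eqquotP/eqP//|h]; apply/eqquotP; rewrite /= /rp_rel h.
Qed.

Lemma rp_typeP (P : rp_type -> Prop) : (forall x, P (rp_class x)) -> forall a, P a.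
Proof. by move=> h a; have := h (repr a); rewrite /rp_class reprK. Qed.

Lemma repr_rp_class x : distI (repr (rp_class x)) x = 0.
Proof. by apply/rp_classP; rewrite /rp_class reprK. Qed.

Definition rp_dist (a b : rp_type) : R := distI (repr a) (repr b).

Lemma rp_dist_class x y : rp_dist (rp_class x) (rp_class y) = distI x y.
Proof.
rewrite /rp_dist; have := repr_rp_class x; have := repr_rp_class y.
move: (repr (rp_class x)) (repr (rp_class y)) => x' y' hy hx.
have h1 := distI_triangle x x' y'; have h2 := distI_triangle y x y'.
have h3 := distI_triangle x' x y; have h4 := distI_triangle y' x' y.
move: h1 h2 h3 h4; rewrite (distI_sym x x') (distI_sym y y') hx hy.
by rewrite !addr0 !add0r => h1 h2 h3 h4; apply/eqP; rewrite eq_le; apply/andP;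
  split; [exact: le_trans h1 h2|exact: le_trans h3 h4].
Qed.

Lemma rp_distxx a : rp_dist a a = 0. Proof. exact: distIxx. Qed.
Lemma rp_dist_pos a b : rp_dist a b = 0 -> a = b.
Proof. by move=> /rp_classP; rewrite /rp_class !reprK. Qed.
Lemma rp_dist_sym a b : rp_dist a b = rp_dist b a.
Proof. exact: distI_sym. Qed.
Lemma rp_dist_triangle b a c : rp_dist a c <= rp_dist a b + rp_dist b c.
Proof. exact: distI_triangle. Qed.

HB.instance Definition _ := isMetric.Build R rp_type
  rp_distxx rp_dist_pos rp_dist_sym rp_dist_triangle.

Lemma rp_mdistE (a b : rp_type) : mdist a b = distI (repr a) (repr b).
Proof. by []. Qed.

Definition rp_pred (P : pred_sym L) (a : 'I_(pred_ar P) -> rp_type) : R :=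
  limsupI I (fun g => pred_int (A g) P (fun i => repr (a i) g)).

Definition rp_fun (f : fun_sym L) (a : 'I_(fun_ar f) -> rp_type) : rp_type :=
  rp_class (fun g => fun_int (A g) f (fun i => repr (a i) g)).

Definition rp_const (c : const_sym L) : rp_type :=
  rp_class (fun g => const_int (A g) c).

Lemma pred_itv (P : pred_sym L) (x : 'I_(pred_ar P) -> X) g :
  0 <= pred_int (A g) P (fun i => x i g) <= 1.
Proof. exact: pred_int_itv. Qed.

Lemma pred_distI (P : pred_sym L) e (x y : 'I_(pred_ar P) -> X) :
  0 < e <= 1 -> (forall i, distI (x i) (y i) < pred_mod P e) ->
  `|limsupI I (fun g => pred_int (A g) P (fun i => x i g)) -
    limsupI I (fun g => pred_int (A g) P (fun i => y i g))| <= e.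
Proof.
move=> e01 xy.
have [S IS hS] := limsupI_family_lt (fun i => dist_itv (x i) (y i)) xy.
apply: (limsupI_dist (pred_itv x) (pred_itv y) IS) => g Sg.
by apply: pred_int_uc => // i; exact: hS.
Qed.

Lemma fun_distI (f : fun_sym L) e (x y : 'I_(fun_ar f) -> X) :
  0 < e <= 1 -> (forall i, distI (x i) (y i) < fun_mod f e) ->
  distI (fun g => fun_int (A g) f (fun i => x i g))
        (fun g => fun_int (A g) f (fun i => y i g)) <= e.
Proof.
move=> e01 xy.
have [S IS hS] := limsupI_family_lt (fun i => dist_itv (x i) (y i)) xy.
apply: (limsupI_le (dist_itv _ _) IS) => g Sg.
by apply: fun_int_uc => // i; exact: hS.
Qed.

Lemma le_small (r : R) : (forall e, 0 < e <= 1 -> r <= e) -> r <= 0.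
Proof.
move=> h; rewrite leNgt; apply/negP => r0.
have [r1|r1] := leP r 1.
- have : r <= r / 2 by apply: h; apply/andP; split; lra.
  lra.
- have : r <= 1 by apply: h; rewrite ltr01 lexx.
  by rewrite leNgt r1.
Qed.

(* Well-definedness: predicates and functions computed on arbitrary
   representatives agree with the interpretations chosen through repr. *)
Lemma rp_pred_class (P : pred_sym L) (x : 'I_(pred_ar P) -> X) :
  rp_pred (fun i => rp_class (x i)) =
  limsupI I (fun g => pred_int (A g) P (fun i => x i g)).
Proof.
apply/eqP; rewrite -subr_eq0 -normr_le0; apply: le_small => e e01.
apply: (pred_distI e01) => i; rewrite repr_rp_class.
by have /andP[] := pred_modP P e01.
Qed.

Lemma rp_fun_class (f : fun_sym L) (x : 'I_(fun_ar f) -> X) :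
  rp_fun (fun i => rp_class (x i)) =
  rp_class (fun g => fun_int (A g) f (fun i => x i g)).
Proof.
apply/rp_classP/eqP; rewrite eq_le distI_ge0 andbT; apply: le_small => e e01.
apply: (fun_distI e01) => i; rewrite repr_rp_class.
by have /andP[] := fun_modP f e01.
Qed.

Lemma rp_inh : inhabited rp_type.
Proof.
have h g : exists a : A g, True by have [a] := carrier_inh (A g); exists a.
by constructor; exact: (rp_class (fun g => projT1 (cid (h g)))).
Qed.

Lemma rp_mdist_le1 (a b : rp_type) : mdist a b <= 1.
Proof.
by rewrite rp_mdistE /distI; have /andP[] := limsupI_itv I (dist_itv (repr a) (repr b)).
Qed.

Lemma rp_pred_itv (P : pred_sym L) a : 0 <= @rp_pred P a <= 1.
Proof. exact: (limsupI_itv I (pred_itv (fun i => repr (a i)))). Qed.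

Lemma rp_pred_uc (P : pred_sym L) e (a b : 'I_(pred_ar P) -> rp_type) :
  0 < e <= 1 -> (forall i, mdist (a i) (b i) < pred_mod P e) ->
  `|rp_pred a - rp_pred b| <= e.
Proof. by move=> e01 ab; exact: (pred_distI e01 ab). Qed.

Lemma rp_fun_uc (f : fun_sym L) e (a b : 'I_(fun_ar f) -> rp_type) :
  0 < e <= 1 -> (forall i, mdist (a i) (b i) < fun_mod f e) ->
  mdist (rp_fun a) (rp_fun b) <= e.
Proof.
by move=> e01 ab; rewrite [mdist _ _]rp_dist_class; exact: (fun_distI e01 ab).
Qed.

Lemma cauchy_seqP (T : metricType R) (u : nat -> T) : cauchy (u @ \oo) <->
  forall e, 0 < e -> exists N, forall m n, (N <= m)%N -> (N <= n)%N ->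
    mdist (u m) (u n) < e.
Proof.
split=> [cu e e0|H].
  have /cauchy_ballP/(_ e e0) := cu.
  case=> -[B C]/= [[N _ hN] [N' _ hN']] BC; exists (maxn N N') => m n.
  rewrite !geq_max => /andP[Nm _] /andP[_ Nn].
  have := BC (u m, u n) (conj (hN m Nm) (hN' n Nn)).
  by rewrite /= ballEmdist.
apply/cauchy_ballP => e e0; have [N hN] := H e e0.
exists (u @` [set n | (N <= n)%N], u @` [set n | (N <= n)%N]).
  by split; exists N => // n /= Nn; exists n.
by move=> [_ _]/= [[m Nm <-] [n Nn <-]]; rewrite ballEmdist /=; exact: hN.
Qed.

Lemma cvg_seqP (T : metricType R) (u : nat -> T) (p : T) : u @ \oo --> p <->
  forall e, 0 < e -> exists N, forall n, (N <= n)%N -> mdist p (u n) < e.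
Proof.
split=> [/cvg_ballP cu e e0|H].
  by have [N _ hN] := cu e e0; exists N => n Nn; have := hN n Nn; rewrite /= ballEmdist.
apply/cvg_ballP => e e0; have [N hN] := H e e0.
by exists N => // n /= Nn; rewrite ballEmdist; exact: hN.
Qed.

Lemma telescope_le (T : metricType R) (u : nat -> T) k l :
  (forall j, (k <= j < k + l)%N -> mdist (u j) (u j.+1) <= 2^-1 ^+ j) ->
  mdist (u k) (u (k + l)%N) <= 2 * 2^-1 ^+ k - 2 * 2^-1 ^+ (k + l).
Proof.
elim: l => [|l IH] h; first by rewrite addn0 mdistxx subrr.
have h1 : mdist (u k) (u (k + l)%N) <= 2 * 2^-1 ^+ k - 2 * 2^-1 ^+ (k + l).
  apply: IH => j /andP[kj jl]; apply: h.
  by rewrite kj addnS ltnS ltnW.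
have h2 : mdist (u (k + l)%N) (u (k + l).+1) <= 2^-1 ^+ (k + l).
  by apply: h; rewrite leq_addr addnS ltnSn.
rewrite addnS (le_trans (metric_triangle _ (u (k + l)%N) _))// exprS; lra.
Qed.

Lemma exp_half_lt (e : R) : 0 < e -> exists k, 2 * 2^-1 ^+ k < e.
Proof.
move=> e0.
have : (2^-1 : R) ^+ n @[n --> \oo] --> (0 : R).
  by apply: cvg_expr; rewrite ger0_norm ?invr_ge0// invf_lt1// ltr1n.
move=> /cvgrPdist_lt/(_ (e / 2)) []; first by rewrite divr_gt0.
move=> N _ /(_ N (leqnn N)) /=; rewrite sub0r normrN ger0_norm ?exprn_ge0 ?invr_ge0//.
by exists N; lra.
Qed.

Lemma rp_complete (u : nat -> rp_type) :
  cauchy (u @ \oo) -> exists p : rp_type, u @ \oo --> p.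
Proof.
move=> /cauchy_seqP cu.
have half_gt0 k : 0 < (2^-1 : R) ^+ k by rewrite exprn_gt0// invr_gt0.
have /choice[N hN] k := cu _ (half_gt0 k).
pose M k := (\max_(i < k.+1) N i)%N.
have NM k : (N k <= M k)%N by rewrite /M (leq_bigmax (ord_max : 'I_k.+1)).
have MS k : (M k <= M k.+1)%N by rewrite /M [leqRHS]big_ord_recr/= leq_maxl.
pose x k : X := repr (u (M k)).
have /choice[S hS] : forall k, exists S, I S /\
    forall g, ~ S g -> mdist (x k g) (x k.+1 g) <= 2^-1 ^+ k.
  move=> k; have : distI (x k) (x k.+1) < 2^-1 ^+ k.
    by apply: hN; [exact: NM|exact: leq_trans (MS k)].
  move=> /(limsupI_lt (dist_itv _ _))[S IS [r rk h]]; exists S; split => // g /h.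
  by move=> /le_trans; apply; exact: ltW.
have Hy g : exists y : A g, forall k, (forall j, (j <= k)%N -> ~ S j g) ->
    mdist (x k g) y <= 2 * 2^-1 ^+ k.
  have tele k l : (forall j, (k <= j < k + l)%N -> ~ S j g) ->
      mdist (x k g) (x (k + l)%N g) <= 2 * 2^-1 ^+ k.
    move=> h; have := @telescope_le (A g) (fun k => x k g) k l.
    move=> /(_ (fun j hj => (hS j).2 g (h j hj))) /le_trans; apply.
    by rewrite gerBl mulr_ge0// ltW.
  have [[m Sm]|nS] := pselect (exists m, S m g).
    have ex : exists m, `[< S m g >] by exists m; apply/asboolP.
    case: (ex_minnP ex) => {Sm}m' /asboolP Sm min.
    exists (x m' g) => k hk.
    have km : (k < m')%N by rewrite ltnNge; apply/negP => /hk.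
    rewrite -(subnKC (ltnW km)); apply: tele => j /andP[_].
    rewrite (subnKC (ltnW km)) => jm Sj.
    by have := min j; rewrite leqNgt jm => /(_ (asboolT Sj)).
  have nSj j : ~ S j g by move=> ?; apply: nS; exists j.
  have [|y xy] := @carrier_complete _ _ (A g) (fun k => x k g).
    apply/cauchy_seqP => e e0.
    have [|k hk] := @exp_half_lt (e / 2); first by rewrite divr_gt0.
    have hk' m : (k <= m)%N -> mdist (x k g) (x m g) <= 2 * 2^-1 ^+ k.
      by move=> km; rewrite -(subnKC km); exact: tele.
    exists k => m n km kn.
    have := metric_triangle (x m g) (x k g) (x n g).
    rewrite (metric_sym (x m g) (x k g)).
    have := hk' m km; have := hk' n kn; lra.
  exists y => k _; apply/ler_addgt0Pr => e e0.
  move/cvg_seqP: xy => /(_ e e0)[n hn].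
  have := hn (k + n)%N (leq_addl _ _); rewrite metric_sym.
  have := metric_triangle (x k g) (x (k + n)%N g) y.
  by have := tele k n (fun j _ => nSj j); lra.
pose y : X := fun g => projT1 (cid (Hy g)).
have xy k : distI (x k) y <= 2 * 2^-1 ^+ k.
  apply: (@limsupI_le _ _ _ _ [set g | exists i : 'I_k.+1, S i g]).
  - exact: dist_itv.
  - by apply: (@ideal_bigU _ _ _ (fun i : 'I_k.+1 => S i)) => i; have [] := hS i.
  - move=> g nS; apply: (projT2 (cid (Hy g))) => j jk Sj; apply: nS.
    by exists (Ordinal (jk : (j < k.+1)%N)).
exists (rp_class y); apply/cvg_seqP => e e0.
have [|k hk] := @exp_half_lt (e / 2); first by rewrite divr_gt0.
exists (M k) => n kn.
have h1 : mdist (rp_class y) (u (M k)) <= 2 * 2^-1 ^+ k.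
  rewrite metric_sym; have <- : rp_class (x k) = u (M k) by rewrite /rp_class reprK.
  by rewrite [mdist _ _]rp_dist_class.
have h2 : mdist (u (M k)) (u n) < 2^-1 ^+ k.
  by apply: hN; rewrite ?NM// (leq_trans (NM k)).
have := metric_triangle (rp_class y) (u (M k)) (u n).
have := half_gt0 k; lra.
Qed.

Definition reduced_product : mstructure L :=
  @MStructure R L rp_type rp_inh rp_mdist_le1 rp_complete
    rp_pred rp_pred_itv rp_pred_uc rp_fun rp_fun_uc rp_const.

End ReducedProduct.

Definition reduced_power (R : realType) (L : language R) (Omega : Type)
    (I : ideal Omega) (A : mstructure L) : mstructure L :=
  reduced_product I (fun _ : Omega => A).

(* Main.v *)
Require Import Defs.
From mathcomp Require Import all_boot all_order all_algebra.
From mathcomp Require Import all_classical all_reals.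
From mathcomp Require Import topology normedtype lra.

(** A finite colouring [c] of the assignments [nat -> A] turns a family
    [x : Omega -> nat -> A] into a finite partition of [Omega]; only which pieces
    of it lie in the ideal will matter.  For every formula [phi] and [e > 0] there
    is a [c] such that two families with the same null colours give [phi] values
    within [e] in the reduced powers, over any two atomless ideals.
    For an atomic formula, [c] records the value of the formula up to [e]; for a
    connective, uniform continuity on the cube allows the product of the colourings
    of the arguments.  For a quantifier over a formula coloured by [c], colour an
    assignment by the set of [c]-colours reachable by changing the quantified
    variable: a witness on one side is copied to the other side by splitting each
    non-null piece into as many non-null parts as there are non-null colours used
    by the witness, which is possible since the ideal is atomless.
    For a sentence, compare constant families, which always have the same null
    colours. *)

Set Implicit Arguments.
Unset Strict Implicit.
Unset Printing Implicit Defensive.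

Import Order.TTheory GRing.Theory Num.Theory.
Import numFieldNormedType.Exports.

Local Open Scope classical_set_scope.
Local Open Scope ring_scope.

(** * Transfer of suprema and infima between two structures *)

Section SupInf.
Context {R : realType} {T U : Type} (F : T -> R) (G : U -> R) (e : R).
Hypotheses (F01 : forall t, 0 <= F t <= 1) (G01 : forall u, 0 <= G u <= 1).

Lemma sup_range_leD (t0 : T) :
  (forall t, exists u, `|F t - G u| <= e) -> sup (range F) <= sup (range G) + e.
Proof.
move=> FG; apply: ge_sup; first by exists (F t0), t0.
move=> _ [t _ <-]; have [u] := FG t.
rewrite ler_distl => /andP[_ h]; apply: (le_trans h).
rewrite lerD2r; apply: ub_le_sup; last by exists u.
by exists 1 => _ [v _ <-]; have /andP[] := G01 v.
Qed.

Lemma inf_range_leD (u0 : U) :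
  (forall u, exists t, `|F t - G u| <= e) -> inf (range F) <= inf (range G) + e.
Proof.
move=> FG; rewrite -lerBlDr; apply: lb_le_inf; first by exists (G u0), u0.
move=> _ [u _ <-]; have [t] := FG u.
rewrite lerBlDr ler_distl => /andP[_ h]; apply: le_trans h.
apply: ge_inf; last by exists t.
by exists 0 => _ [v _ <-]; have /andP[] := F01 v.
Qed.

End SupInf.

(** Heine-Cantor on the compact cube, stated coordinatewise. *)
Lemma connective_unif_continuous (R : realType) (k : nat) (u : connective R k)
    (e : R) : 0 < e -> exists2 d, 0 < d & forall x y : 'rV[R]_k,
  unit_cube x -> unit_cube y -> (forall i, `|x ord0 i - y ord0 i| <= d) ->
  `|u x - u y| <= e.
Proof.
move=> e0.
have cube_compact : compact (@unit_cube R k).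
  have := @rV_compact R k (fun=> `[0, 1]%classic) (fun=> @segment_compact R 0 1).
  by congr (compact _); apply/seteqP; split => v /= h i; have := h i;
    rewrite /= in_itv.
have e2 : 0 < e / 2 by rewrite divr_gt0.
(* The near-covering form of compactness turns a radius [d] that works near each point, as [d] tends
   to 0 from the right, into one that works on the whole cube. *)
have /compact_near_coveringP/near_covering_withinP := cube_compact.
move=> /(_ R 0^'+ (fun d x => forall y, unit_cube y -> ball x d y -> `|u x - u y| <= e)).
have cts := iffLR (subspace_continuousP _ _) (@conn_cts _ _ u).
case.
  move=> x cx; have /cvgrPdist_lt/(_ _ e2) := cts x cx.
  rewrite /within/= => /nbhs_ballP[r /= r0 hr].
  have r2 : 0 < r / 2 by rewrite divr_gt0.
  (* With these halves both [z] and [y] stay in the ball of radius [r] around [x]. *)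
  exists (ball x (r / 2), [set d | d < r / 2]).
    by split => /=; [exact: nbhsx_ballx|exact: nbhs_right_lt].
  move=> [z d] /= [xz dr] cz y cy zy.
  have h1 : `|u x - u z| < e / 2.
    by apply: hr => //; apply: le_ball xz; lra.
  have h2 : `|u x - u y| < e / 2.
    apply: hr => //; have -> : r = r / 2 + r / 2 by lra.
    by apply: (ball_triangle xz); apply: le_ball zy; exact: ltW.
  by rewrite (le_trans (ler_distD (u x) _ _))// distrC; lra.
(* Radius [r / 2] is admissible; [r / 4] leaves room for the strict inequality in its ball. *)
move=> r /= r0 hr; exists (r / 4) => [|x y cx cy xy]; first by rewrite divr_gt0.
have r2 : 0 < r / 2 by rewrite divr_gt0.
apply: (hr (r / 2)) cx _ cy _ => //=.
  by rewrite sub0r normrN gtr0_norm//; lra.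
split => // i j; rewrite (ord1 i) /ball/=; apply: le_lt_trans (xy j) _; lra.
Qed.

(** * Null patterns of finite colourings *)

Section SameNull.
Context {Om1 Om2 : Type} (I : ideal Om1) (J : ideal Om2).

Definition same_null (C : Type) (p : Om1 -> C) (q : Om2 -> C) : Prop :=
  forall k, I [set g | p g = k] <-> J [set g | q g = k].

End SameNull.

Lemma same_null_sym (Om1 Om2 : Type) (I : ideal Om1) (J : ideal Om2) (C : Type)
    (p : Om1 -> C) (q : Om2 -> C) : same_null I J p q -> same_null J I q p.
Proof. by move=> pq k; rewrite pq. Qed.

Lemma ideal_finU (Omega : Type) (I : ideal Omega) (C : finType)
    (S : C -> set Omega) :
  (forall k, I (S k)) -> I [set g | exists k, S k g].
Proof.
move=> IS.
have := @ideal_bigU _ I #|C| (fun i => S (enum_val i)) (fun i => IS _).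
by apply: idealS => g [k Sk]; exists (enum_rank k); rewrite enum_rankK.
Qed.

(** A set defined by colours is a finite union of colour classes, and ideals are closed under finite
    unions. *)
Lemma same_null_pred (Om1 Om2 : Type) (I : ideal Om1) (J : ideal Om2)
    (C : finType) (p : Om1 -> C) (q : Om2 -> C) (P : C -> Prop) :
  same_null I J p q -> I [set g | P (p g)] -> J [set g | P (q g)].
Proof.
move=> pq IP.
have : forall k, J [set g | q g = k /\ P k].
  move=> k; have [Pk|nPk] := pselect (P k).
    have /pq : I [set g | p g = k] by apply: idealS IP => g /= ->.
    by apply: idealS => g [].
  by apply: idealS (ideal0 J) => g [].
by move=> /ideal_finU; apply: idealS => g /= Pg; exists (q g).
Qed.

Lemma same_null_comp (Om1 Om2 : Type) (I : ideal Om1) (J : ideal Om2)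
    (C : finType) (D : Type) (h : C -> D) (p : Om1 -> C) (q : Om2 -> C) :
  same_null I J p q -> same_null I J (h \o p) (h \o q).
Proof.
move=> pq k; split; first exact: (@same_null_pred _ _ I J C p q (fun c => h c = k)).
exact: (@same_null_pred _ _ J I C q p (fun c => h c = k) (same_null_sym pq)).
Qed.

(** Induction on the list: cut [S] into two non-null parts, give one to [k0] and split the other
    among the remaining colours. *)
Lemma atomless_split (Omega : Type) (J : ideal Omega) (C : eqType) (k0 : C)
    (s : seq C) (S : set Omega) : atomless J -> ~ J S ->
  exists2 f : Omega -> C, (forall g, f g \in k0 :: s) &
    forall k, k \in k0 :: s -> ~ J [set g | S g /\ f g = k].
Proof.
move=> /atomlessP aJ; elim: s k0 S => [|k1 s IH] k0 S nS.
  exists (fun=> k0) => [g|k]; rewrite inE// => /eqP->.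
  by apply: contra_not nS; apply: idealS => g.
have [T [TS nT nST]] := aJ S nS; have [f fs fS] := IH k1 _ nST.
exists (fun g => if `[< T g >] then k0 else f g) => [g|k].
  by case: ifP => _; rewrite in_cons ?eqxx// fs orbT.
rewrite in_cons => /orP[/eqP->|ks].
  apply: contra_not nT; apply: idealS => g Tg /=; split; first exact: TS.
  by rewrite asboolT.
apply: contra_not (fS k ks); apply: idealS => g [[Sg Tg] fg] /=; split => //.
by rewrite asboolF.
Qed.

(** The back-and-forth step: [s] is built separately on each piece [q = D], imitating the null
    pattern of [r] on [p = D]. *)
Lemma same_null_extend (Om1 Om2 : Type) (I : ideal Om1) (J : ideal Om2)
    (C : finType) (p : Om1 -> {set C}) (q : Om2 -> {set C}) (r : Om1 -> C) :
  atomless J -> same_null I J p q ->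
  (forall g, r g \in p g) -> (forall g, q g != finset.set0) ->
  exists2 s : Om2 -> C, (forall g, s g \in q g) & same_null I J r s.
Proof.
move=> aJ pq rp q0.
have [g0 _] := ideal_notin (ideal0 I).
have /choice[f hf] : forall D : {set C}, exists f : Om2 -> C, D != finset.set0 ->
    (forall g, f g \in D) /\ forall k,
      I [set g | p g = D /\ r g = k] <-> J [set g | q g = D /\ f g = k].
  move=> D; have [->|/set0Pn[k1 k1D]] := eqVneq D finset.set0.
    by exists (fun=> r g0).
  (* On a null piece any colour of [D] will do. *)
  have [ID|nID] := pselect (I [set g | p g = D]).
    exists (fun=> k1) => _; split=> // k; split=> _.
      by apply: idealS (iffLR (pq D) ID) => g [].
    by apply: idealS ID => g [].
  (* [K] lists the colours that [r] uses non-negligibly on the piece; it is nonempty, or the piece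
     would be a finite union of null sets. *)
  pose K := [seq k <- enum C | `[< ~ I [set g | p g = D /\ r g = k] >]].
  have inK k : (k \in K) = `[< ~ I [set g | p g = D /\ r g = k] >].
    by rewrite mem_filter mem_enum andbT.
  have : exists k, k \in K.
    apply: contrapT => nK; apply: nID.
    have : forall k, I [set g | p g = D /\ r g = k].
      by move=> k; apply: contrapT => n; apply: nK; exists k; rewrite inK asboolT.
    by move=> /ideal_finU; apply: idealS => g /= gD; exists (r g).
  case defK : K => [|k0 s]; first by case.
  move=> _; have nJD : ~ J [set g | q g = D] by move=> /pq.
  have [f fK fJ] := atomless_split k0 s aJ nJD.
  rewrite -defK in fK fJ.
  exists f => _; split=> [g|k].
    have := fK g; rewrite inK => /asboolP n; apply: contrapT => nD; apply: n.
    by apply: idealS (ideal0 I) => h [pD rf]; apply: nD; rewrite -rf -pD.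
  have [kK|] := boolP (k \in K).
    split; last by move=> /(fJ k kK).
    by move: kK; rewrite inK => /asboolP n /n.
  rewrite inK => /asboolPn /contrapT Ik; split=> // _.
  apply: idealS (ideal0 J) => g [_ fg]; have := fK g.
  by rewrite fg inK => /asboolP; apply.
exists (fun g => f (q g) g) => [g|k]; first exact: (hf _ (q0 g)).1.
(* Each colour class is the finite union of its traces on the pieces, so it is null iff all traces
   are. *)
split=> h.
- have : forall D, J [set g | q g = D /\ f (q g) g = k].
    move=> D; have [->|D0] := eqVneq D finset.set0.
      by apply: idealS (ideal0 J) => g [qg _]; have := q0 g; rewrite qg eqxx.
    suff /(hf D D0).2 : I [set g | p g = D /\ r g = k].
      by apply: idealS => g /= [->].
    by apply: idealS h => g [].
  by move=> /ideal_finU; apply: idealS => g /= sg; exists (q g).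
- have : forall D, I [set g | p g = D /\ r g = k].
    move=> D; have [->|D0] := eqVneq D finset.set0.
      by apply: idealS (ideal0 I) => g [pg _]; have := rp g; rewrite pg inE.
    apply/(hf D D0).2; apply: idealS h => g /= [qD fk].
    by rewrite qD.
  by move=> /ideal_finU; apply: idealS => g /= sg; exists (p g).
Qed.

(** * Finite colourings that determine a limsup up to [e] *)

Section Buckets.
Context {R : realType} {T : Type} (F : T -> R) (n : nat).

(** Recording all thresholds above the value makes each bound [F t <= i / (n + 1)] a property of the
    colour; [i] runs up to [n + 1], so 1 is a threshold. *)
Definition bucket (t : T) : {set 'I_n.+2} :=
  [set i : 'I_n.+2 | F t <= i%:R / n.+1%:R]%SET.

Hypothesis F01 : forall t, 0 <= F t <= 1.

Lemma limsupI_bucket_le (Om1 Om2 : Type) (I : ideal Om1) (J : ideal Om2)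
    (x : Om1 -> T) (y : Om2 -> T) :
  same_null I J (bucket \o x) (bucket \o y) ->
  limsupI I (F \o x) <= limsupI J (F \o y) + n.+1%:R^-1.
Proof.
move=> xy; set r := limsupI J _.
have Fx01 g : 0 <= (F \o x) g <= 1 := F01 (x g).
have Fy01 g : 0 <= (F \o y) g <= 1 := F01 (y g).
have n0 : 0 < n.+1%:R :> R by rewrite ltr0n.
have [r1|r1] := leP 1 (r + n.+1%:R^-1).
  by apply: le_trans r1; have /andP[] := limsupI_itv I Fx01.
have r0 : 0 <= r by exact: limsupI_ge0.
have rn0 : 0 <= r * n.+1%:R by rewrite mulr_ge0// ltW.
have /andP[tr rt] := Num.Theory.truncn_itv rn0.
(* [(m + 1) / (n + 1)] is the first threshold strictly above [r]. Off a null set [F \o y] lies below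
   it, and equal null colours pass this on to [F \o x]. *)
set m := Num.truncn _ in tr rt.
have mr : m.+1%:R / n.+1%:R <= r + n.+1%:R^-1.
  by rewrite ler_pdivrMr// mulrDl mulVf ?gt_eqF// -natr1 lerD2r.
have rm : r < m.+1%:R / n.+1%:R by rewrite ltr_pdivlMr.
have mn : (m.+1 < n.+2)%N.
  rewrite -(ltr_nat R) -[n.+2%:R]natr1.
  have := le_lt_trans mr r1; rewrite ltr_pdivrMr// mul1r => /lt_trans; apply.
  by rewrite ltrDl.
apply: le_trans mr; pose i := Ordinal mn.
have [S JS [r' r'm hS]] := limsupI_lt Fy01 rm.
have JN : J [set g | i \notin (bucket \o y) g].
  apply: idealS JS => g /=; rewrite inE => /negP Fi.
  by apply: contrapT => /hS Fr; apply: Fi; apply: le_trans Fr (ltW r'm).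
have IN := same_null_pred (P := fun b : {set 'I_n.+2} => i \notin b)
  (same_null_sym xy) JN.
apply: (limsupI_le Fx01 IN) => g /negP.
by rewrite negbK inE.
Qed.

End Buckets.

Lemma limsupI_colouring (R : realType) (T : Type) (F : T -> R) (e : R) :
  (forall t, 0 <= F t <= 1) -> 0 < e ->
  exists (C : finType) (c : T -> C),
    forall (Om1 Om2 : Type) (I : ideal Om1) (J : ideal Om2) x y,
    same_null I J (c \o x) (c \o y) ->
    `|limsupI I (F \o x) - limsupI J (F \o y)| <= e.
Proof.
move=> F01 e0; pose n := Num.truncn e^-1.
have ne : n.+1%:R^-1 <= e.
  by rewrite invf_ple ?posrE// ltW// truncnS_gt.
exists {set 'I_n.+2}, (bucket F n) => Om1 Om2 I J x y xy.
have h1 := limsupI_bucket_le F01 xy.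
have h2 := limsupI_bucket_le F01 (same_null_sym xy).
by rewrite ler_distl lerBlDr (le_trans h2) ?(le_trans h1) ?lerD2l.
Qed.

(** * Colourings for formulas, and the conclusion *)

Section ReducedPower.
Context {R : realType} {L : language R} (A : mstructure L).

Definition fam_class (Omega : Type) (I : ideal Omega) (x : Omega -> nat -> A) :
    nat -> reduced_power I A :=
  fun n => rp_class I (fun g => x g n).

Lemma fam_class_upd (Omega : Type) (I : ideal Omega) x n (b : Omega -> A) :
  upd (fam_class I x) n (rp_class I b) =
  fam_class I (fun g => upd (x g) n (b g)).
Proof. by apply/funext => m; rewrite /fam_class /upd; case: eqP. Qed.

Lemma teval_fam (Omega : Type) (I : ideal Omega) x (t : term L) :
  teval (fam_class I x) t = rp_class I (fun g => teval (x g) t).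
Proof.
elim: t => [n|c|f ts IH] //=.
rewrite -(rp_fun_class I (fun i g => teval (x g) (ts i))).
by congr rp_fun; apply/funext.
Qed.

Definition colours (phi : formula L) (e : R) : Prop :=
  exists (C : finType) (c : (nat -> A) -> C),
    forall (Om1 Om2 : Type) (I : ideal Om1) (J : ideal Om2),
    atomless I -> atomless J -> forall x y,
    same_null I J (c \o x) (c \o y) ->
    `|feval phi (fam_class I x) - feval phi (fam_class J y)| <= e.

Lemma colours_conn k (u : connective R k) (phis : 'I_k -> formula L) :
  (forall i e, 0 < e -> colours (phis i) e) ->
  forall e, 0 < e -> colours (Conn u phis) e.
Proof.
move=> IH e e0; have [d d0 ud] := connective_unif_continuous u e0.
pose C i := projT1 (cid (IH i d d0)).
pose c i : (nat -> A) -> C i := projT1 (cid (projT2 (cid (IH i d d0)))).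
have hc i := projT2 (cid (projT2 (cid (IH i d d0)))).
exists {dffun forall i, C i}, (fun v => [ffun i => c i v]).
move=> Om1 Om2 I J aI aJ x y xy /=.
apply: ud => [i|i|i]; rewrite !mxE; try exact: feval_itv.
apply: hc => //.
(* The colouring of each argument is a coordinate of the product colouring. *)
have := same_null_comp (fun d : {dffun forall i, C i} => d i) xy.
by congr same_null; apply/funext => g /=; rewrite ffunE.
Qed.

(** Serves [Sup] and [Inf] alike; swapping [I] and [J] gives the converse direction. *)
Lemma colours_quantifier (psi : formula L) (n : nat) (e : R) : colours psi e ->
  exists (D : finType) (d : (nat -> A) -> D),
    forall (Om1 Om2 : Type) (I : ideal Om1) (J : ideal Om2),
    atomless I -> atomless J -> forall x y,
    same_null I J (d \o x) (d \o y) ->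
    forall a : reduced_power I A, exists b : reduced_power J A,
    `|feval psi (upd (fam_class I x) n a) - feval psi (upd (fam_class J y) n b)| <= e.
Proof.
move=> [C [c hc]].
pose d (v : nat -> A) := [set k | `[< exists a, c (upd v n a) = k >]]%SET.
exists {set C}, d => Om1 Om2 I J aI aJ x y xy; apply: rp_typeP => a.
have [a0] := carrier_inh A.
have [| |s sd rs] := same_null_extend (r := fun g => c (upd (x g) n (a g))) aJ xy.
- by move=> g; rewrite inE; apply/asboolP; exists (a g).
- move=> g; apply/set0Pn; exists (c (upd (y g) n a0)).
  by rewrite inE; apply/asboolP; exists a0.
(* Each colour [s g] is reachable from [y g], so a witness can be chosen coordinatewise. *)
have /choice[b hb] : forall g, exists b, c (upd (y g) n b) = s g.
  by move=> g; have := sd g; rewrite inE => /asboolP.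
exists (rp_class J b); rewrite !fam_class_upd; apply: hc => //.
by have -> : c \o (fun g => upd (y g) n (b g)) = s by apply/funext.
Qed.

Lemma feval_colours (phi : formula L) (e : R) : 0 < e -> colours phi e.
Proof.
elim: phi e => [s t|P ts|k u phis IH|n psi IH|n psi IH] e e0.
- have [|C [c hc]] := @limsupI_colouring R (nat -> A)
    (fun v => mdist (teval v s) (teval v t)) e _ e0.
    by move=> v; rewrite mdist_ge0 mdist_le1.
  exists C, c => Om1 Om2 I J _ _ x y /hc /=.
  by rewrite !teval_fam ![mdist (rp_class _ _) _]rp_dist_class.
- have [|C [c hc]] := @limsupI_colouring R (nat -> A)
    (fun v => pred_int A P (fun i => teval v (ts i))) e _ e0.
    by move=> v; exact: pred_int_itv.
  exists C, c => Om1 Om2 I J _ _ x y /hc /=.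
  have E Om (K : ideal Om) z : rp_pred (fun i => teval (fam_class K z) (ts i)) =
      limsupI K (fun g => pred_int A P (fun i => teval (z g) (ts i))).
    rewrite -(rp_pred_class K (fun i g => teval (z g) (ts i))).
    by congr rp_pred; apply/funext => i; rewrite teval_fam.
  by rewrite !E.
- exact: colours_conn.
- have [D [d hd]] := colours_quantifier n (IH e e0).
  exists D, d => Om1 Om2 I J aI aJ x y xy /=.
  have [a0] := carrier_inh (reduced_power I A).
  have [b0] := carrier_inh (reduced_power J A).
  have h1 := sup_range_leD (fun=> feval_itv _ _) a0 (hd _ _ _ _ aI aJ _ _ xy).
  have h2 := sup_range_leD (fun=> feval_itv _ _) b0
    (hd _ _ _ _ aJ aI _ _ (same_null_sym xy)).
  by rewrite ler_distl lerBlDr h1 h2.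
- have [D [d hd]] := colours_quantifier n (IH e e0).
  exists D, d => Om1 Om2 I J aI aJ x y xy /=.
  have [a0] := carrier_inh (reduced_power I A).
  have [b0] := carrier_inh (reduced_power J A).
  rewrite ler_distl lerBlDr; apply/andP; split.
  + apply: (inf_range_leD _ a0) => [b|a]; first exact: feval_itv.
    have [b] := hd _ _ _ _ aI aJ _ _ xy a.
    by exists b; rewrite distrC.
  + apply: (inf_range_leD _ b0) => [a|b]; first exact: feval_itv.
    have [a] := hd _ _ _ _ aJ aI _ _ (same_null_sym xy) b.
    by exists a; rewrite distrC.
Qed.

End ReducedPower.

Theorem theorem3p7 (R : realType) (L : language R) (A : mstructure L)
    (Omega : Type) (I J : ideal Omega)
    (hI : atomless I) (hJ : atomless J) :
  elem_equiv (reduced_power I A) (reduced_power J A).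
Proof.
move=> phi sphi v w; have [a0] := carrier_inh A.
pose x (_ : Omega) (_ : nat) := a0.
rewrite (feval_sentence v (fam_class I x) sphi).
rewrite (feval_sentence w (fam_class J x) sphi).
apply/eqP; rewrite -subr_eq0 -normr_le0; apply: le_small => e /andP[e0 _].
have [C [c hc]] := feval_colours A phi e0.
(* A colour class of a constant family is all of [Omega], non-null since ideals are proper, or
   empty. *)
apply: hc => // k /=; have [<-|ck] := pselect (c (fun=> a0) = k).
  by split=> /ideal_notin[g /(_ erefl)].
by split=> _; [apply: idealS (ideal0 J)|apply: idealS (ideal0 I)].
Qed.
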